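(* Let $d\ge1$ be an integer and $\mathfrak d=\langle x_1^d,\dots,x_n^d\rangle\subset R$. Let $k$ be an integer with $n\le k\le d$ and let $\mathbf u\in\operatorname{comp}(k,n)$. Suppose $p>nd-n$ and $p\nmid d$. If $s=\inf\{e\ge1:\|[p^e\mathbf u\,\%\,d]\|>d\}$, then $$\operatorname{crit}(\mathfrak d,\mathbf u)=\frac kd-\frac{\|[p^s\mathbf u\,\%\,d]\|-d}{d\,p^s},$$ where this formula is interpreted to agree with $k/d$ if $s=\infty$.
   Context: $p$ is a prime, $\Bbbk$ is a field of characteristic $p$ with $[\Bbbk:\Bbbk^p]<\infty$, $n\ge1$, $R=\Bbbk[x_1,\dots,x_n]$. For integers $m$ and $d\ge1$, $[m\,\%\,d]$ is the least positive residue of $m$ modulo $d$ (an element of $\{1,\dots,d\}$); for $\mathbf v\in\mathbb Z^n$, $[\mathbf v\,\%\,d]=([v_1\,\%\,d],\dots,[v_n\,\%\,d])$. For $\mathbf v\in\mathbb N^n$, $\|\mathbf v\|=v_1+\cdots+v_n$. $\operatorname{comp}(k,n)$ is the set of $\mathbf u\in\mathbb N^n$ with all coordinates positive and $\|\mathbf u\|=k$. For $\mathbf u\in\mathbb N^n$ with positive coordinates, $\operatorname{diag}(\mathbf u)=\langle x_1^{u_1},\dots,x_n^{u_n}\rangle$. For an ideal $\mathfrak b$ and $e\ge0$, $\mathfrak b^{[p^e]}=\langle f^{p^e}:f\in\mathfrak b\rangle$. If $m\in\mathbb N$ has base $p$ expansion $m=m_0+m_1p+\cdots+m_rp^r$,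 the Frobenius power is $\mathfrak a^{[m]}=\mathfrak a^{m_0}(\mathfrak a^{m_1})^{[p]}\cdots(\mathfrak a^{m_r})^{[p^r]}$. For a nonzero proper ideal $\mathfrak a$ and a proper ideal $\mathfrak b$ with $\mathfrak a\subseteq\sqrt{\mathfrak b}$, and $q=p^e$, $\mu(\mathfrak a,\mathfrak b,q)=\max\{m\in\mathbb N:\mathfrak a^{[m]}\not\subseteq\mathfrak b^{[q]}\}$ and $\operatorname{crit}(\mathfrak a,\mathfrak b)=\lim_{q\to\infty}\mu(\mathfrak a,\mathfrak b,q)/q$ (the limit exists). We write $\operatorname{crit}(\mathfrak a,\mathbf u)$ for $\operatorname{crit}(\mathfrak a,\operatorname{diag}(\mathbf u))$. *)

(* Defs.v *)
From mathcomp Require Import all_boot all_order all_algebra.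
From mathcomp Require Import boolp classical_sets reals topology normedtype.
From mathcomp Require Import sequences.
(* The notations of mpoly clash with those of mathcomp-analysis. *)
From mathcomp Require Import -(notations) mpoly.

Set Implicit Arguments.
Unset Strict Implicit.
Unset Printing Implicit Defensive.

Import Order.TTheory GRing.Theory Num.Theory.
Import numFieldNormedType.Exports.

Local Open Scope classical_set_scope.
Local Open Scope ring_scope.

Section Ideals.
Variable A : comNzRingType.
Implicit Types (I J a b : set A) (m q : nat).

Definition is_ideal I : Prop :=
  [/\ I 0, forall f g, I f -> I g -> I (f + g) & forall c f, I f -> I (c * f)].

Definition ideal_gen (S : set A) : set A := smallest is_ideal S.

Definition idealM I J : set A := ideal_gen [set f * g | f in I & g in J].

Definition idealX I m : set A := iter m (idealM I) setT.

(* b^{[q]} *)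
Definition bracket_pow I q : set A := ideal_gen [set f ^+ q | f in I].

(* a^{[m]}: the i-th base p digit of m is (m %/ p ^ i) %% p, and the top
   digit has index trunc_log p m. *)
Definition frob_pow (p : nat) a m : set A :=
  \big[idealM/setT]_(0 <= i < (trunc_log p m).+1)
    bracket_pow (idealX a ((m %/ p ^ i) %% p)%N) (p ^ i)%N.

(* m = mu(a, b, q), as an attained maximum *)
Definition is_mu (p : nat) a b q m : Prop :=
  ~ (frob_pow p a m `<=` bracket_pow b q) /\
  forall m', ~ (frob_pow p a m' `<=` bracket_pow b q) -> (m' <= m)%N.

(* crit(a, b) = c, including that all the maxima and the limit exist *)
Definition is_crit (R : realType) (p : nat) a b (c : R) : Prop :=
  exists mu : nat -> nat,
    (forall e, is_mu p a b (p ^ e)%N (mu e)) /\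
    ((mu e)%:R / (p ^ e)%:R : R) @[e --> \oo] --> c.

End Ideals.

(* [K : K^p] < oo, via a finite family spanning K over K^p *)
Definition finite_over_pth_powers (p : nat) (K : fieldType) : Prop :=
  exists (r : nat) (b : 'I_r -> K),
    forall x : K, exists c : 'I_r -> K, x = \sum_(i < r) c i ^+ p * b i.

(* <x_1^{u_1}, ..., x_n^{u_n}> *)
Definition diag (K : fieldType) (n : nat) (u : 'I_n -> nat) : set (mpoly n K) :=
  ideal_gen (range (fun i : 'I_n => (mpolyX K (mnm1 i) : mpoly n K) ^+ u i)).
Arguments diag K {n} u.

Definition vnorm (n : nat) (v : 'I_n -> nat) : nat := (\sum_(i < n) v i)%N.

Definition compositions (k n : nat) : set ('I_n -> nat) :=
  [set u | (forall i, (0 < u i)%N) /\ vnorm u = k].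
Arguments compositions k n : clear implicits.

(* least positive residue, in {1, ..., d} for d > 0 *)
Definition lpr (m : int) (d : nat) : nat :=
  if (d%:Z %| m)%Z then d else `|(m %% d%:Z)%Z|%N.

Definition vlpr (n : nat) (v : 'I_n -> int) (d : nat) : 'I_n -> nat :=
  fun i => lpr (v i) d.

(* s = inf S in N u {oo}, with None standing for oo *)
Definition is_inf (S : set nat) (s : option nat) : Prop :=
  if s is Some s0 then S s0 /\ (forall e, S e -> (s0 <= e)%N) else S = set0.

(* Main.v *)
(* Everything is monomial: the Frobenius power d^{[m]} is generated by the x^{dv}
   such that |v| = m and the entries of v add up to m without carrying in base p.
   Hence mu(d, diag(u), p^e) is the largest |v| over the v that add without
   carrying and satisfy d v_i < p^e u_i, that is, v <= t(e), where t(e) is p^e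
   times the truncation of u / d to e nonterminating base p digits.  One has
   d t(e) + w(e) = p^e u with w(e) = [p^e u % d], so the digits of place e sum up
   to (p ||w(e-1)|| - ||w(e)||) / d.  As long as ||w(i)|| <= d for all i < e, t(e)
   adds without carrying and is optimal.  If ||w(s)|| > d for the first time, the
   digits of place s+1 sum up to at least p (as p > nd - n >= nd - d), so one can
   lower them to a vector of sum p - 1 with a strictly smaller entry, whose later
   digits may all be taken to be p - 1; this gives
   mu(d, diag(u), p^e) = (|t(s)| + 1) p^(e-s) - 1 for e > s, the upper bound being
   clear from the absence of carries. *)
Require Import Defs.
From mathcomp Require Import all_boot all_order all_algebra.
From mathcomp Require Import boolp classical_sets reals topology normedtype.
From mathcomp Require Import sequences.
From mathcomp Require Import -(notations) mpoly.
From mathcomp Require Import zify ring.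

Set Implicit Arguments.
Unset Strict Implicit.
Unset Printing Implicit Defensive.

Import Order.TTheory GRing.Theory Num.Theory.
Import numFieldNormedType.Exports.

Local Open Scope classical_set_scope.
Local Open Scope ring_scope.

(** * Generators of products and of bracket powers *)

Section IdealGen.
Variable A : comNzRingType.
Implicit Types (I J S T : set A) (f g : A).

Lemma ideal_gen_ideal S : is_ideal (ideal_gen S).
Proof.
split.
- by move=> I [[I0 _ _] _].
- by move=> f g Sf Sg I SI; have [[_ ID _] _] := SI; apply: ID; [exact: Sf|exact: Sg].
- by move=> c f Sf I SI; have [[_ _ IM] _] := SI; apply: IM; exact: Sf.
Qed.

(** The [f] that multiply all of [ideal_gen T] into a given ideal form an ideal, so membership can
    be checked on generators, one factor at a time. *)
Lemma ideal_gen_idealM S T :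
  idealM (ideal_gen S) (ideal_gen T) = ideal_gen [set f * g | f in S & g in T].
Proof.
set U := [set f * g | f in S & g in T].
have [U0 UD UM] := ideal_gen_ideal U.
apply/seteqP; split; last first.
  apply: sub_smallest2r; first exact: ideal_gen_ideal.
  move=> _ [f Sf [g Tg <-]].
  by exists f; [exact: sub_gen_smallest|exists g => //; exact: sub_gen_smallest].
apply: smallest_sub; first exact: ideal_gen_ideal.
move=> _ [f Sf [g Tg <-]].
suff SU : ideal_gen S `<=` [set f | forall g, ideal_gen T g -> ideal_gen U (f * g)].
  exact: SU.
apply: smallest_sub.
  split=> [h _|f1 f2 H1 H2 h Th|c f1 H1 h Th] /=.
  - by rewrite mul0r.
  - by rewrite mulrDl; apply: UD; [apply: H1|apply: H2].
  - by rewrite -mulrA; apply: UM; apply: H1.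
move=> f1 Sf1 /=; apply: smallest_sub.
  split=> [|g1 g2 H1 H2|c g1 H1] /=.
  - by rewrite mulr0.
  - by rewrite mulrDr; apply: UD.
  - by rewrite mulrCA; apply: UM.
by move=> g1 Tg1 /=; apply: sub_gen_smallest; exists f1 => //; exists g1.
Qed.

(** In characteristic [p], raising to the power [p ^ e] is additive, so the [f] whose power lies in
    the right-hand ideal form an ideal. *)
Lemma bracket_pow_ideal_gen p e S : p \in [pchar A] ->
  bracket_pow (ideal_gen S) (p ^ e)%N = ideal_gen [set f ^+ (p ^ e) | f in S].
Proof.
move=> pA; have pp := pcharf_prime pA; set U := [set f ^+ _ | f in S].
have [U0 UD UM] := ideal_gen_ideal U.
apply/seteqP; split; last first.
  apply: sub_smallest2r; first exact: ideal_gen_ideal.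
  by move=> _ [f Sf <-]; exists f => //; exact: sub_gen_smallest.
apply: smallest_sub; first exact: ideal_gen_ideal.
move=> _ [f Sf <-].
suff SU : ideal_gen S `<=` [set f | ideal_gen U (f ^+ (p ^ e))] by exact: SU.
apply: smallest_sub.
  split=> [|f1 f2 H1 H2|c f1 H1] /=.
  - by rewrite expr0n expn_eq0 (gtn_eqF (prime_gt0 pp)).
  - rewrite exprDn_pchar; first exact: UD.
    by rewrite (eq_pnat _ (pcharf_eq pA)) pnatX pnat_id.
  - by rewrite exprMn; apply: UM.
by move=> f1 Sf1 /=; apply: sub_gen_smallest; exists f1.
Qed.

End IdealGen.

(** * Monomial ideals, handled through their sets of exponents *)

Section MonomialIdeals.
Variables (K : fieldType) (n : nat).
Implicit Types (S T : set (multinom n)) (m : multinom n).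

Definition mono_ideal S : set (mpoly n K) :=
  ideal_gen [set mpolyX K m | m in S].

Definition add_exps S T : set (multinom n) :=
  [set mnm_add a b | a in S & b in T].

(** The polynomials each of whose monomials is divisible by some [x^a] with [a] in [S] form an ideal
    containing the generators. *)
Lemma mono_idealX S m :
  mono_ideal S (mpolyX K m) <-> exists2 a, S a & forall i, (a i <= m i)%N.
Proof.
split=> [Sm|[a Sa am]]; last first.
  have -> : m = mnm_add (mnm_sub m a) a.
    by apply/mnmP => i; rewrite mnmDE mnmBE subnK.
  rewrite mpolyXD; have [_ _ SM] := ideal_gen_ideal [set mpolyX K m | m in S].
  by apply: SM; apply: sub_gen_smallest; exists a.
suff SU : mono_ideal S `<=` [set f : mpoly n K |
    forall m, m \in msupp f -> exists2 a, S a & forall i, (a i <= m i)%N].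
  by apply: (SU _ Sm); rewrite msuppX mem_head.
apply: smallest_sub.
  split=> [m0|f g Hf Hg m0|c f Hf m0] /=.
  - by rewrite msupp0.
  - by move/msuppD_le; rewrite mem_cat => /orP[/Hf|/Hg].
  - move/msuppM_le/allpairsP => [[m1 m2] /= [_ /Hf [a Sa am] ->]].
    by exists a => // i; rewrite mnmDE; apply: leq_trans (am i) (leq_addl _ _).
by move=> _ [a Sa <-] m0 /mem_msuppXP <-; exists a.
Qed.

Lemma mono_ideal_sub S T :
  mono_ideal S `<=` mono_ideal T <->
  forall a, S a -> exists2 b, T b & forall i, (b i <= a i)%N.
Proof.
split=> [ST a Sa|H].
  by apply/mono_idealX; apply: ST; apply/mono_idealX; exists a.
apply: smallest_sub; first exact: ideal_gen_ideal.
by move=> _ [a Sa <-]; apply/mono_idealX; exact: H.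
Qed.

Lemma mono_ideal0 : mono_ideal [set @mnm0 n] = setT.
Proof.
apply/seteqP; split=> // f _.
have [_ _ SM] := ideal_gen_ideal [set mpolyX K m | m in [set @mnm0 n]].
rewrite -[f]mulr1 -mpolyX0; apply: SM.
by apply: sub_gen_smallest; exists (@mnm0 n).
Qed.

Lemma mono_idealM S T :
  mono_ideal (add_exps S T) = idealM (mono_ideal S) (mono_ideal T).
Proof.
rewrite ideal_gen_idealM; congr ideal_gen; apply/seteqP; split.
  move=> _ [_ [a Sa [b Tb <-]] <-]; exists (mpolyX K a); first by exists a.
  by exists (mpolyX K b); [exists b|rewrite mpolyXD].
move=> _ [_ [a Sa <-] [_ [b Tb <-] <-]].
by exists (mnm_add a b); [exists a => //; exists b|rewrite mpolyXD].
Qed.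

Lemma mono_ideal_exp S (k : nat) :
  idealX (mono_ideal S) k = mono_ideal (iter k (add_exps S) [set @mnm0 n]).
Proof.
elim: k => [|k IHk]; first by rewrite mono_ideal0.
by rewrite /idealX !iterS -/(idealX _ _) IHk mono_idealM.
Qed.

Lemma bracket_pow_mono_ideal p e S : p \in [pchar K] ->
  bracket_pow (mono_ideal S) (p ^ e)%N =
  mono_ideal [set mnm_muln m (p ^ e)%N | m in S].
Proof.
move=> pK; rewrite bracket_pow_ideal_gen ?pchar_lalg //.
congr ideal_gen; apply/seteqP; split.
  move=> _ [_ [a Sa <-] <-]; exists (mnm_muln a (p ^ e)); first by exists a.
  by rewrite mpolyXn.
by move=> _ [_ [a Sa <-] <-]; exists (mpolyX K a); [exists a|rewrite mpolyXn].
Qed.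

Lemma diag_mono_ideal (u : 'I_n -> nat) :
  diag K u = mono_ideal (range (fun i => mnm_muln (mnm1 i) (u i))).
Proof.
congr ideal_gen; apply/seteqP; split.
  move=> _ [i _ <-]; exists (mnm_muln (mnm1 i) (u i)); first by exists i.
  by rewrite mpolyXn.
by move=> _ [_ [i _ <-] <-]; exists i => //; rewrite mpolyXn.
Qed.

Lemma bigop_add_exps (I : eqType) (r : seq I) (F : I -> set (multinom n)) v :
  uniq r ->
  (\big[add_exps/[set @mnm0 n]]_(i <- r) F i) v <->
  exists2 a : I -> multinom n, (forall i, i \in r -> F i (a i)) &
    forall j, v j = (\sum_(i <- r) a i j)%N.
Proof.
elim: r v => [|i r IHr] v.
  move=> _; rewrite big_nil; split=> [->|[a _ va]].
    by exists (fun=> @mnm0 n) => // j; rewrite big_nil mnm0E.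
  by apply/mnmP => j; rewrite va big_nil mnm0E.
move=> /= /andP[ir ur]; rewrite big_cons; split.
  move=> [b Fb [c /(IHr _ ur) [a Fa ca] <-]].
  exists (fun j => if j == i then b else a j).
    move=> j; rewrite inE; case: eqVneq => [-> //|_ /=]; exact: Fa.
  move=> j; rewrite mnmDE big_cons eqxx ca; congr addn.
  apply: eq_big_seq => l lr; case: eqVneq => // li.
  by rewrite -li lr in ir.
move=> [a Fa va]; exists (a i); first by apply: Fa; rewrite mem_head.
have ar j : j \in r -> F j (a j) by move=> jr; apply: Fa; rewrite inE jr orbT.
exists (\big[@mnm_add n/@mnm0 n]_(l <- r) a l).
  by apply/IHr => //; exists a => // j; rewrite mnm_sumE.
by apply/mnmP => j; rewrite mnmDE mnm_sumE va big_cons.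
Qed.

(** Each factor contributes one [x_i^d], and [a] counts how often each [i] is picked. *)
Lemma iter_add_exps_diag (d m : nat) v :
  (iter m (add_exps (range (fun i : 'I_n => mnm_muln (mnm1 i) d))) [set @mnm0 n]) v
  <-> exists2 a : multinom n, mdeg a = m & v = mnm_muln a d.
Proof.
elim: m v => [|m IHm] v.
  split=> [->|[a /eqP]]; last first.
    by rewrite mdeg_eq0 => /eqP -> ->; apply/mnmP => i; rewrite mulmnE !mnm0E.
  by exists (@mnm0 n); rewrite ?mdeg0 //; apply/mnmP => i; rewrite mulmnE !mnm0E.
rewrite iterS; split.
  move=> [_ [i _ <-] [w /IHm [a am ->] <-]].
  exists (mnm_add (mnm1 i) a); first by rewrite mdegD mdeg1 am.
  by apply/mnmP => j; rewrite !(mulmnE, mnmDE) mulnDl.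
move=> [a am ->]; have [i ai] : exists i, (0 < a i)%N.
  apply: contrapT => H; move: am; rewrite mdegE big1 // => i _.
  by apply/eqP; rewrite -leqn0 leqNgt; apply/negP => ?; apply: H; exists i.
have aE : a = mnm_add (mnm1 i) (mnm_sub a (mnm1 i)).
  apply/mnmP => j; rewrite mnmDE mnmBE subnKC // mnm1E.
  by case: eqVneq => [<-|].
exists (mnm_muln (mnm1 i) d); first by exists i.
exists (mnm_muln (mnm_sub a (mnm1 i)) d).
  apply/IHm; exists (mnm_sub a (mnm1 i)) => //.
  by move: am; rewrite {1}aE mdegD mdeg1 => -[].
by apply/mnmP => j; rewrite [in RHS]aE !(mulmnE, mnmDE) mulnDl.
Qed.

(** Both ideals are monomial, so non-inclusion means that some generator [x^(d v)], with [v] the sum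
    of the [p ^ l * a l], is divisible by none of the [x_j^(p^e u_j)]. *)
Lemma frob_pow_diag_not_sub p e d (m : nat) (u : 'I_n -> nat) : p \in [pchar K] ->
  ~ (frob_pow p (diag K (fun=> d)) m `<=` bracket_pow (diag K u) (p ^ e)) <->
  exists2 a : nat -> multinom n,
    (forall l, (l < (trunc_log p m).+1)%N -> mdeg (a l) = (m %/ p ^ l) %% p)%N &
    forall j, (d * \sum_(0 <= l < (trunc_log p m).+1) p ^ l * a l j
               < p ^ e * u j)%N.
Proof.
move=> pK; set L := (trunc_log p m).+1.
pose F l := [set mnm_muln b (p ^ l) | b in
  iter ((m %/ p ^ l) %% p)
    (add_exps (range (fun i : 'I_n => mnm_muln (mnm1 i) d))) [set @mnm0 n]].
rewrite /frob_pow -/L !diag_mono_ideal bracket_pow_mono_ideal //.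
rewrite (eq_bigr (fun l => mono_ideal (F l))); last first.
  by move=> l _; rewrite mono_ideal_exp bracket_pow_mono_ideal.
rewrite -(big_morph mono_ideal mono_idealM mono_ideal0) mono_ideal_sub.
split.
- move=> /existsNP [v /not_implyP [/bigop_add_exps H vH]].
  have [a aF va] := H (iota_uniq _ _).
  (* The bound on [l] sits inside the existential so that [choice] gives a total function; [mnm0] is
     a dummy value beyond the top digit. *)
  have aF' l : exists b : multinom n, (l < L)%N ->
      mdeg b = ((m %/ p ^ l) %% p)%N /\ forall j, a l j = (d * (p ^ l * b j))%N.
    have [lL|_] := boolP (l < L)%N; last by exists (@mnm0 n).
    have [|_ /iter_add_exps_diag [b bm ->] <-] := aF l; first by rewrite mem_index_iota.
    by exists b => _; split=> // j; rewrite !mulmnE; ring.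
  have [b bP] := choice aF'; exists b => [l lL|j]; first by have [] := bP l lL.
  rewrite ltnNge; apply/negP => uj; apply: vH.
  exists (mnm_muln (mnm_muln (mnm1 j) (u j)) (p ^ e)).
    by exists (mnm_muln (mnm1 j) (u j)) => //; exists j.
  move=> i; rewrite !mulmnE mnm1E; case: eqVneq => [<-|] //.
  rewrite mul1n mulnC (leq_trans uj) // va big_distrr /= !big_mkord leq_sum // => l _.
  by have [_ ->] := bP l (ltn_ord l).
- move=> [a am au] H.
  have [] := H (\big[@mnm_add n/@mnm0 n]_(0 <= l < L)
    mnm_muln (mnm_muln (a l) d) (p ^ l)).
    apply/bigop_add_exps; first exact: iota_uniq.
    exists (fun l => mnm_muln (mnm_muln (a l) d) (p ^ l)) => [l|j]; last first.
      by rewrite mnm_sumE.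
    rewrite mem_index_iota => /= lL; exists (mnm_muln (a l) d) => //.
    by apply/iter_add_exps_diag; exists (a l) => //; exact: am.
  move=> _ [_ [j _ <-] <-] /(_ j); rewrite !mulmnE mnm1E eqxx mul1n mnm_sumE.
  rewrite mulnC leqNgt => /negP; apply; apply: leq_trans (au j).
  rewrite ltnS big_distrr /= !big_mkord leq_sum // => l _.
  by rewrite !mulmnE; nia.
Qed.

End MonomialIdeals.

(** * Base [p] digits and addition without carrying *)

Local Open Scope nat_scope.

Lemma sum_base_digits p m L :
  \sum_(0 <= l < L) p ^ l * ((m %/ p ^ l) %% p) = m %% p ^ L.
Proof.
elim: L => [|L IHL]; first by rewrite big_nil modn1.
rewrite big_nat_recr //= IHL expnS [RHS](divn_eq _ (p ^ L)) -modn_divl.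
by rewrite modn_dvdm ?dvdn_mull // mulnC addnC.
Qed.

(** The terms with [l >= i] vanish modulo [p ^ i]. Equality may fail, since the [a l] need not be
    less than [p]. *)
Lemma sum_digits_modn p (a : nat -> nat) L i :
  (\sum_(0 <= l < L) p ^ l * a l) %% p ^ i <=
  \sum_(0 <= l < minn L i) p ^ l * a l.
Proof.
have [Li|/ltnW iL] := leqP L i; first exact: leq_mod.
rewrite (big_cat_nat (leq0n i) iL) /=.
suff /dvdnP [x ->] : p ^ i %| \sum_(i <= l < L) p ^ l * a l.
  by rewrite addnC modnMDl leq_mod.
rewrite big_seq; apply: dvdn_sum => l; rewrite mem_index_iota => /andP[il _].
by rewrite dvdn_mulr // dvdn_exp2l.
Qed.

(* By Lucas and Kummer, this says that the multinomial coefficient of [v] is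
   prime to [p]: adding the entries of [v] in base [p] produces no carry out of
   the digits of weight less than [p ^ i]. *)
Definition carry_free (n p : nat) (v : 'I_n -> nat) : Prop :=
  forall i, \sum_j v j %% p ^ i < p ^ i.

Section CarryFree.
Variables (n p : nat).
Hypothesis p1 : 1 < p.
Implicit Types (v x y c D : 'I_n -> nat).

Let pX_gt0 i : 0 < p ^ i. Proof. by rewrite expn_gt0 (ltnW p1). Qed.

(** Without carries, division by [p ^ i] commutes with the sum, so each digit of the sum is the sum
    of the digits of the entries. This matches [carry_free] with the digit vectors occurring in
    Frobenius powers. *)
Lemma carry_free_digits v :
  carry_free p v <->
  exists2 a : nat -> 'I_n -> nat,
    forall l, \sum_j a l j = ((\sum_j v j) %/ p ^ l) %% p &
    forall j, v j =
      \sum_(0 <= l < (trunc_log p (\sum_j v j)).+1) p ^ l * a l j.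
Proof.
set m := \sum_j v j; set L := (trunc_log p m).+1.
have mL : m < p ^ L by exact: trunc_log_ltn.
split=> [cf|[a am va] i]; last first.
  apply: leq_ltn_trans (_ : \sum_(0 <= l < minn L i) p ^ l * ((m %/ p ^ l) %% p) < _).
    under [leqRHS]eq_bigr do rewrite -am big_distrr /=.
    by rewrite exchange_big leq_sum // => j _; rewrite va sum_digits_modn.
  rewrite sum_base_digits; apply: leq_trans (ltn_pmod _ (pX_gt0 _)) _.
  by rewrite leq_exp2l // geq_minr.
have mdiv i : m %/ p ^ i = \sum_j v j %/ p ^ i.
  rewrite /m (eq_bigr _ (fun j _ => divn_eq (v j) (p ^ i))) big_split /=.
  by rewrite -big_distrl /= divnMDl // divn_small // addn0.
exists (fun l j => (v j %/ p ^ l) %% p) => [l|j].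
  (* Adding the higher digits back turns the claim into additivity of the quotients by [p ^ l]. *)
  apply/(@addnI (m %/ p ^ l.+1 * p)).
  rewrite {2}expnSr divnMA -divn_eq mdiv big_distrl -big_split /=.
  by rewrite mdiv; apply: eq_bigr => j _; rewrite expnSr divnMA -divn_eq.
rewrite sum_base_digits modn_small //; apply: leq_ltn_trans mL.
by rewrite /m (bigD1 j) ?leq_addr.
Qed.

Lemma carry_free_small c : \sum_j c j < p -> carry_free p c.
Proof.
move=> cp [|i]; first by rewrite big1 // => j _; rewrite modn1.
apply: leq_ltn_trans (_ : \sum_j c j < _); first by apply: leq_sum => j _; exact: leq_mod.
by apply: leq_trans cp _; rewrite expnS leq_pmulr.
Qed.

Lemma carry_free1 j0 N : carry_free p (fun j : 'I_n => (j == j0) * N).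
Proof.
move=> i; rewrite (bigD1 j0) //= eqxx mul1n big1 ?addn0 ?ltn_pmod //.
by move=> j /negPf ->; rewrite mul0n mod0n.
Qed.

(** [y] occupies only the [f] lowest places and the shifted [x] only the places above. *)
Lemma carry_free_shift x y f :
  carry_free p x -> carry_free p y -> \sum_j y j < p ^ f ->
  carry_free p (fun j => x j * p ^ f + y j).
Proof.
move=> cx cy yf i; have [fi|fi] := leqP i f.
  rewrite (eq_bigr (fun j => y j %% p ^ i)) // => j _.
  by rewrite -(subnK fi) expnD mulnA modnMDl.
rewrite -(subnK (ltnW fi)) expnD; set g := i - f.
apply: leq_ltn_trans (_ : \sum_j ((x j %% p ^ g) * p ^ f + y j) < _).
  apply: leq_sum => j _; rewrite {1}(divn_eq (x j) (p ^ g)).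
  by rewrite mulnDl -mulnA -addnA modnMDl leq_mod.
rewrite big_split /= -big_distrl /=.
apply: (@leq_trans ((\sum_j x j %% p ^ g) * p ^ f + p ^ f)); first by rewrite ltn_add2l.
by rewrite -mulSnr leq_mul2r cx orbT.
Qed.

Lemma exists_sum_below D N : N <= \sum_j D j ->
  exists2 c, forall j, c j <= D j & \sum_j c j = N.
Proof.
elim: N => [|N IHN] ND; first by exists (fun=> 0) => //; rewrite big1.
have [c cD cN] := IHN (ltnW ND).
have [j0 cj0] : exists j, c j < D j.
  apply: contrapT => H; move: ND; rewrite -cN ltnNge => /negP; apply.
  by apply: leq_sum => j _; rewrite leqNgt; apply/negP => ?; apply: H; exists j.
exists (fun j => (j == j0) + c j) => [j|].
  by case: eqVneq => [->|_] /=; rewrite ?add1n ?add0n.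
by rewrite big_split /= cN (bigD1 j0) //= eqxx big1 // => j /negPf ->.
Qed.

End CarryFree.

(** The digit vectors [a l], with weights [p ^ l], assemble to [v]; conversely [carry_free_digits]
    extracts them from [v]. *)
Lemma frob_pow_diag_carry_free (p : nat) (K : fieldType) n d e m (u : 'I_n -> nat) :
  p \in [pchar K] ->
  ~ (frob_pow p (diag K (fun=> d)) m `<=` bracket_pow (diag K u) (p ^ e)) <->
  exists2 v : 'I_n -> nat,
    carry_free p v /\ \sum_j v j = m & forall j, d * v j < p ^ e * u j.
Proof.
move=> pK; have p1 : 1 < p by exact/prime_gt1/pcharf_prime/pK.
rewrite frob_pow_diag_not_sub //; split=> [[a am au]|[v [cf vm] vu]].
  (* [a l] is unconstrained above the top digit of [m], so a boolean factor makes it zero there. *)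
  have dig l : \sum_j a l j * (l < (trunc_log p m).+1) = (m %/ p ^ l) %% p.
    rewrite -big_distrl /=; case: ltnP => lL; first by rewrite muln1 -mdegE am.
    by rewrite muln0 divn_small ?mod0n // (leq_trans (trunc_log_ltn m p1)) // leq_exp2l.
  pose v j := \sum_(0 <= l < (trunc_log p m).+1) p ^ l * a l j.
  have vm : \sum_j v j = m.
    rewrite /v exchange_big /= -[RHS](modn_small (trunc_log_ltn m p1)) -sum_base_digits.
    rewrite !big_mkord; apply: eq_bigr => l _.
    by rewrite -big_distrr /= -dig ltn_ord; congr muln; apply: eq_bigr => j _; rewrite muln1.
  exists v; last by [].
  split=> //; apply/carry_free_digits => //; rewrite vm.
  exists (fun l j => a l j * (l < (trunc_log p m).+1)) => // j.
  by rewrite /v !big_mkord; apply: eq_bigr => l _; rewrite ltn_ord muln1.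
have [a am va] := (carry_free_digits p1 v).1 cf; rewrite vm in am va.
exists (fun l => Multinom [tuple a l j | j < n]) => [l _|j].
  by rewrite mdegE -am; apply: eq_bigr => j _; rewrite mnmE.
by under eq_bigr do rewrite mnmE; rewrite -va.
Qed.

(** Shifting by one before and after [%%] makes multiples of [d] give [d] instead of zero. *)
Lemma lpr_pos (N d : nat) : 0 < N -> 0 < d -> lpr N%:Z d = (N.-1 %% d).+1.
Proof.
case: N => // N _ d0; rewrite /lpr dvdzE modz_nat !absz_nat /=.
have := ltn_pmod N d0; rewrite leq_eqVlt => /orP[/eqP rd|rd].
  have -> : d %| N.+1 by rewrite (divn_eq N d) -addnS rd dvdn_add // dvdn_mull.
  by rewrite rd.
by rewrite /dvdn {1 2}(divn_eq N d) -addnS modnMDl modn_small.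
Qed.

(** * Truncated base [p] expansions of the [u j / d] *)

Section Truncation.
Variables (n p d : nat) (u : 'I_n -> nat).
Hypotheses (p1 : 1 < p) (d0 : 0 < d) (u0 : forall j, 0 < u j).

(* [trunc e j] is [p ^ e] times the truncation to [e] base [p] digits of the
   nonterminating expansion of [u j / d], and [rem e j] is [p^e u_j % d]. *)
Definition trunc e j := (p ^ e * u j).-1 %/ d.
Definition rem e j := ((p ^ e * u j).-1 %% d).+1.

Let pX_gt0 i : 0 < p ^ i. Proof. by rewrite expn_gt0 (ltnW p1). Qed.

Lemma trunc_rem e j : d * trunc e j + rem e j = p ^ e * u j.
Proof. by rewrite /rem addnS mulnC -divn_eq prednK // muln_gt0 pX_gt0 u0. Qed.

(** The [.-1] in [trunc] absorbs the strictness of the inequality; this is why nonterminating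
    expansions appear. *)
Lemma lt_trunc e j v : (d * v < p ^ e * u j) = (v <= trunc e j).
Proof.
have N0 : 0 < p ^ e * u j by rewrite muln_gt0 pX_gt0 u0.
by rewrite /trunc leq_divRL // -[in LHS](prednK N0) ltnS mulnC.
Qed.

(** The divisions by [d] and by [p ^ i] commute, and [(p ^ i * x.+1).-1] has quotient [x] by
    [p ^ i]. *)
Lemma trunc_divX e i j : trunc (i + e) j %/ p ^ i = trunc e j.
Proof.
rewrite /trunc divnAC expnD -mulnA; congr (_ %/ d).
case: (p ^ e * u j) => [|x]; first by rewrite muln0 div0n.
have -> : (p ^ i * x.+1).-1 = x * p ^ i + (p ^ i).-1 by have := pX_gt0 i; nia.
by rewrite divnMDl // divn_small ?addn0 // prednK.
Qed.

(** Subtracting [p ^ i] times [trunc_rem] at [e] from [trunc_rem] at [i + e] leaves the last [i]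
    digits. For [i = 1] this is one step of long division. *)
Lemma trunc_modX e i j : d * (trunc (i + e) j %% p ^ i) + rem (i + e) j = p ^ i * rem e j.
Proof.
have := trunc_rem (i + e) j; rewrite (divn_eq (trunc (i + e) j) (p ^ i)) trunc_divX.
rewrite expnD -mulnA -trunc_rem => E; apply/(@addnI (p ^ i * (d * trunc e j))).
by rewrite -mulnDr -E modnMDl modn_mod; ring.
Qed.

Lemma sum_trunc_modX e i :
  d * (\sum_j trunc (i + e) j %% p ^ i) + \sum_j rem (i + e) j =
  p ^ i * (\sum_j rem e j).
Proof.
by rewrite !big_distrr -big_split /=; apply: eq_bigr => j _; exact: trunc_modX.
Qed.

Lemma sum_rem_le e : \sum_j rem e j <= n * d.
Proof.
have -> : n * d = \sum_(j < n) d by rewrite sum_nat_const card_ord.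
apply: leq_sum => j _.
exact: ltn_pmod.
Qed.

(** Absence of carries keeps the contribution of the [g] lowest places below [p ^ g]; the parts
    above are at most [trunc s]. *)
Lemma carry_free_le_trunc s g v : carry_free p v ->
  (forall j, d * v j < p ^ (g + s) * u j) ->
  \sum_j v j < (\sum_j trunc s j).+1 * p ^ g.
Proof.
move=> cf vu; rewrite (eq_bigr _ (fun j _ => divn_eq (v j) (p ^ g))) big_split /=.
rewrite -big_distrl /=.
apply: (@leq_trans ((\sum_j v j %/ p ^ g) * p ^ g + p ^ g)); first by rewrite ltn_add2l.
rewrite -mulSnr leq_mul2r ltnS; apply/orP; right; apply: leq_sum => j _.
by rewrite -(trunc_divX s g) leq_div2r // -lt_trunc.
Qed.

(** This attains the bound of [carry_free_le_trunc] with [g = f.+1]. *)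
Lemma exists_carry_free s f :
  carry_free p (trunc s) -> d < \sum_j rem s j -> n * d - d < p ->
  exists2 v, carry_free p v /\ \sum_j v j = ((\sum_j trunc s j).+1 * p ^ f.+1).-1
    & forall j, d * v j < p ^ (f + s.+1) * u j.
Proof.
move=> cf ds pnd; pose D j := trunc s.+1 j %% p.
(* If the digits of place [s + 1] summed to at most [p - 1], then
   [p * (d + 1) <= d * (p - 1) + n * d], that is, [p <= n * d - d]. *)
have pD : p <= \sum_j D j.
  have := sum_trunc_modX s 1; rewrite add1n expn1 -/(\sum_j D j).
  rewrite leqNgt; move=> E; apply/negP => Dp.
  have := sum_rem_le s.+1.
  have : p * d.+1 <= p * \sum_j rem s j by rewrite leq_mul2l ds orbT.
  have : d * (\sum_j D j).+1 <= d * p by rewrite leq_mul2l Dp orbT.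
  rewrite !mulnS (mulnC p d); lia.
have [c cD cp] := @exists_sum_below n D p.-1 (leq_trans (leq_pred p) pD).
(* The sums differ, [p - 1] against at least [p]; the strict entry leaves room for any [f] further
   digits. *)
have [j0 cj0] : exists j, c j < D j.
  apply: contrapT => H; move: pD; rewrite leqNgt => /negP; apply.
  rewrite -[p in _ < p](prednK (ltnW p1)) ltnS -cp.
  by apply: leq_sum => j _; rewrite leqNgt; apply/negP => ?; apply: H; exists j.
have tS j : trunc s.+1 j = trunc s j * p + D j.
  by rewrite {1}(divn_eq (trunc s.+1 j) p) -(trunc_divX s 1) add1n expn1.
pose x j := trunc s j * p ^ 1 + c j.
have cfx : carry_free p x.
  apply: carry_free_shift => //; last by rewrite cp expn1 prednK // ltnW.
  by apply: carry_free_small => //; rewrite cp prednK // ltnW.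
(* All [f] digits of [(p ^ f).-1] are [p - 1], and giving them to a single coordinate creates no
   carry. *)
pose y j := (j == j0) * (p ^ f).-1.
have ysum : \sum_j y j = (p ^ f).-1.
  by rewrite -big_distrl /= (bigD1 j0) //= eqxx big1 ?mul1n // => j /negPf ->.
exists (fun j => x j * p ^ f + y j) => [|j].
  split; first by apply: carry_free_shift => //; [exact: carry_free1 | rewrite ysum prednK].
  rewrite big_split /= ysum -big_distrl /= big_split /= cp -big_distrl /= expn1 expnS.
  have := pX_gt0 f; set P := p ^ f; set T := \sum_j _; move: p1; clear.
  case: p => // q _; case: P => // P _ /=; rewrite !mulSn; lia.
have vj : x j * p ^ f + y j <= trunc s.+1 j * p ^ f.
  rewrite tS /x /y expn1; case: eqVneq => [->|_]; last first.
    by rewrite addn0 leq_mul2r leq_add2l cD orbT.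
  rewrite mul1n; apply: (@leq_trans ((trunc s j0 * p + c j0).+1 * p ^ f)).
    by rewrite mulSn addnC leq_add2r leq_pred.
  by rewrite leq_mul2r -addnS leq_add2l cj0 orbT.
rewrite expnD -mulnA; apply: (@leq_ltn_trans (d * (trunc s.+1 j * p ^ f))).
  by rewrite leq_mul2l vj orbT.
by rewrite mulnA mulnC ltn_pmul2l // lt_trunc.
Qed.

Variable k : nat.
Hypotheses (n1 : 0 < n) (kd : k <= d) (uk : \sum_j u j = k).

Lemma sum_trunc_rem e : d * (\sum_j trunc e j) + \sum_j rem e j = p ^ e * k.
Proof.
by rewrite -uk !big_distrr -big_split /=; apply: eq_bigr => j _; exact: trunc_rem.
Qed.

Lemma sum_rem_gt0 e : 0 < \sum_j rem e j.
Proof. by rewrite (bigD1 (Ordinal n1)). Qed.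

(** [k <= d] forces every [u j <= d], so each entry is its own least positive residue. *)
Lemma rem0 : \sum_j rem 0 j = k.
Proof.
rewrite -uk; apply: eq_bigr => j _; rewrite /rem mul1n modn_small ?prednK //.
by apply: leq_trans kd; rewrite -uk (bigD1 j) ?leq_addr.
Qed.

(** For [i < e], [sum_trunc_modX] and positivity of the residues bound [d] times the sum of the last
    [i] digits strictly by [p ^ i * \sum_j rem (e - i) j]. *)
Lemma carry_free_trunc e :
  (forall i, i < e -> \sum_j rem i j <= d) -> carry_free p (trunc e).
Proof.
move=> He i; have H0 := sum_rem_gt0 e; have [ei|ie] := leqP e i; last first.
  have := sum_trunc_modX (e - i) i; rewrite (subnKC (ltnW ie)) => E.
  case: i ie E => [|i] ie E; first by rewrite big1 ?expn0 // => j _; rewrite modn1.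
  have {}He := He (e - i.+1) ltac:(lia).
  rewrite -(ltn_pmul2l d0); apply: (@leq_trans (p ^ i.+1 * \sum_j rem (e - i.+1) j)).
    by rewrite -E -[X in X < _]addn0 ltn_add2l.
  by rewrite mulnC leq_mul2r He orbT.
(* For [i >= e] the whole sum is already below [p ^ e], because [k <= d]. *)
apply: (@leq_ltn_trans (\sum_j trunc e j)).
  by apply: leq_sum => j _; exact: leq_mod.
apply: (@leq_trans (p ^ e)); last by rewrite leq_exp2l.
rewrite -(ltn_pmul2l d0); apply: (@leq_trans (p ^ e * k)).
  by rewrite -sum_trunc_rem -[X in X < _]addn0 ltn_add2l.
by rewrite mulnC leq_mul2r kd orbT.
Qed.

End Truncation.

(* Passage to the limit and the critical value *)
Local Close Scope nat_scope.

(** A bounded error divided by [p ^ e] tends to zero. *)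
Lemma cvg_nat_div_expn (R : realType) (p e0 : nat) (mu : nat -> nat) (c C : R) :
  (1 < p)%N ->
  (forall e, (e0 <= e)%N -> `|(mu e)%:R - c * (p ^ e)%:R| <= C) ->
  ((mu e)%:R / (p ^ e)%:R : R) @[e --> \oo] --> c.
Proof.
move=> p1 H; have p0 : 0 < p%:R :> R by rewrite ltr0n ltnW.
have C0 : (C * p%:R^-1 ^+ e : R) @[e --> \oo] --> (0 : R).
  apply: cvg_geometric; rewrite ger0_norm ?invr_ge0 ?ltW // invf_lt1 //.
  by rewrite ltr1n.
have lo : (c - C * p%:R^-1 ^+ e : R) @[e --> \oo] --> c.
  by rewrite -[X in _ --> X]subr0; apply: cvgB => //; exact: cvg_cst.
have hi : (c + C * p%:R^-1 ^+ e : R) @[e --> \oo] --> c.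
  by rewrite -[X in _ --> X]addr0; apply: cvgD => //; exact: cvg_cst.
apply: squeeze_cvgr lo hi; near=> e.
have pe0 : 0 < (p ^ e)%:R :> R by rewrite natrX exprn_gt0.
have /H : (e0 <= e)%N by near: e; exists e0.
rewrite ler_distl exprVn -natrX => /andP[lo hi].
by rewrite ler_pdivlMr // ler_pdivrMr // mulrBl mulrDl divfK ?gt_eqF // lo hi.
Unshelve. all: by end_near.
Qed.

Theorem theorem4p8 (R : realType) (p : nat) (K : fieldType)
  (hp : prime p) (hK : p \in [pchar K]) (hKfin : finite_over_pth_powers p K)
  (n : nat) (hn : (1 <= n)%N) (d : nat) (hd : (1 <= d)%N)
  (k : nat) (hnk : (n <= k)%N) (hkd : (k <= d)%N)
  (u : 'I_n -> nat) (hu : compositions k n u)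
  (hpn : (n * d - n < p)%N) (hpd : ~~ (p %| d)%N)
  (s : option nat)
  (hs : is_inf [set e : nat | (1 <= e)%N /\
                  (d < vnorm (vlpr (fun i => (p ^ e * u i)%N%:Z) d))%N] s) :
  is_crit p (diag K (fun _ : 'I_n => d)) (diag K u)
    (if s is Some s0 then
       k%:R / d%:R
       - ((vnorm (vlpr (fun i => (p ^ s0 * u i)%N%:Z) d))%:R - d%:R)
         / (d%:R * (p ^ s0)%:R)
     else k%:R / d%:R : R).
Proof.
have p1 := prime_gt1 hp; have [u0 uk] := hu.
have normE e : vnorm (vlpr (fun i => (p ^ e * u i)%N%:Z) d) = (\sum_j rem p d u e j)%N.
  by apply: eq_bigr => j _; rewrite /vlpr lpr_pos // muln_gt0 expn_gt0 ltnW ?u0.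
have ach e m := frob_pow_diag_carry_free d e m u hK.
have bound e m : (exists2 v : 'I_n -> nat, carry_free p v /\ (\sum_j v j)%N = m &
    forall j, (d * v j < p ^ e * u j)%N) -> (m <= \sum_j trunc p d u e j)%N.
  by move=> [v [_ <-] vu]; apply: leq_sum => j _; rewrite -lt_trunc.
(* The maximum exists because the zero vector is admissible and [bound] caps the sums. *)
have /choice [mu muP] : forall e, exists m,
    is_mu p (diag K (fun=> d)) (diag K u) (p ^ e)%N m.
  move=> e; pose P m := `[< exists2 v : 'I_n -> nat,
    carry_free p v /\ (\sum_j v j)%N = m & forall j, (d * v j < p ^ e * u j)%N >].
  have P0 : exists m, P m.
    exists 0%N; apply/asboolP; exists (fun=> 0%N) => [|j].
      by split=> [i|]; rewrite big1 ?expn_gt0 ?(ltnW p1) // => j _; rewrite mod0n.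
    by rewrite muln0 muln_gt0 expn_gt0 ltnW ?u0.
  have Pmax m : P m -> (m <= \sum_j trunc p d u e j)%N by move=> /asboolP /bound.
  case: (ex_maxnP P0 Pmax) => m /asboolP Pm mmax; exists m; split; first exact/ach.
  by move=> m' /ach Pm'; apply: mmax; apply/asboolP.
have mu_ach e := (ach e (mu e)).1 (muP e).1.
have mu_max e m v : carry_free p v -> (\sum_j v j)%N = m ->
    (forall j, (d * v j < p ^ e * u j)%N) -> (m <= mu e)%N.
  by move=> cf vm vu; apply: (muP e).2; apply/ach; exists v.
have dR : d%:R != 0 :> R by rewrite pnatr_eq0 -lt0n.
have pR e : (p ^ e)%:R != 0 :> R by rewrite pnatr_eq0 -lt0n expn_gt0 ltnW.
have sumE e : d%:R * (\sum_j trunc p d u e j)%:R + (\sum_j rem p d u e j)%:R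
    = (p ^ e)%:R * k%:R :> R.
  by rewrite -!natrM -natrD (sum_trunc_rem d p1 u0 uk).
(* The infimum ranges over [e >= 1] only; place [0] is settled by [k <= d]. *)
have remk : (\sum_j rem p d u 0 j <= d)%N by rewrite (rem0 p u0 hkd uk).
exists mu; split=> //; case: s hs => [s [[s0 ds] smin]|sempty].
  have cf : carry_free p (trunc p d u s).
    apply: (carry_free_trunc p1 hd u0 hn hkd uk) => // -[//|i] si.
    rewrite leqNgt; apply/negP => di.
    have /smin : [set e : nat | (1 <= e)%N /\
        (d < vnorm (vlpr (fun i => (p ^ e * u i)%N%:Z) d))%N] (i.+1)%N by rewrite /= normE.
    by rewrite leqNgt si.
  rewrite normE in ds *.
  (* For [e > s] the error is exactly [-1]. *)
  apply: (@cvg_nat_div_expn _ _ s.+1 _ _ 1) => // e se.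
  pose T := (\sum_j trunc p d u s j)%N.
  have -> : mu e = (T.+1 * p ^ (e - s)).-1%N.
    have [v [cfv vm] vu] := mu_ach e; apply/eqP; rewrite eqn_leq; apply/andP; split.
      rewrite -ltnS prednK ?muln_gt0 ?expn_gt0 ?(ltnW p1) //.
      by rewrite -vm; apply: carry_free_le_trunc => // j; rewrite subnK // ltnW.
    have ndp : (n * d - d < p)%N.
      by apply: leq_ltn_trans hpn; rewrite leq_sub2l // (leq_trans hnk).
    have [w [cfw wm] wu] := exists_carry_free p1 hd u0 (e - s.+1) cf ds ndp.
    rewrite -subnSK // -wm.
    apply: (mu_max e _ w) => // j.
    by have := wu j; rewrite subnK.
  have -> : (p ^ e)%N = (p ^ s * p ^ (e - s))%N by rewrite -expnD subnKC // ltnW.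
  have -> : ((T.+1 * p ^ (e - s)).-1)%:R = (T.+1)%:R * (p ^ (e - s))%:R - 1 :> R.
    by rewrite -subn1 natrB ?natrM // muln_gt0 expn_gt0 (ltnW p1).
  rewrite natrM mulrA mulrBl.
  (* The claimed limit times [p ^ s] is the integer [T.+1], since [d * T] is [p ^ s * k] minus the
     sum of the residues. *)
  have -> : k%:R / d%:R * (p ^ s)%:R -
      ((\sum_j rem p d u s j)%:R - d%:R) / (d%:R * (p ^ s)%:R) * (p ^ s)%:R
      = (T.+1)%:R :> R.
    apply: (mulfI dR); rewrite -natr1 [RHS]mulrDr mulr1.
    have := sumE s; rewrite -/T => E.
    have -> : d%:R * T%:R = (p ^ s)%:R * k%:R - (\sum_j rem p d u s j)%:R :> R.
      by rewrite -E addrK.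
    by field; rewrite dR pR.
  by rewrite addrAC subrr add0r normrN normr1.
have small i : (\sum_j rem p d u i j <= d)%N.
  case: i => [//|i]; rewrite leqNgt; apply/negP => di.
  by have : (set0 : set nat) (i.+1)%N by rewrite -sempty /= normE.
apply: (@cvg_nat_div_expn _ _ 0 _ _ 1) => // e _.
have -> : mu e = (\sum_j trunc p d u e j)%N.
  apply/eqP; rewrite eqn_leq bound //=; apply: (mu_max e _ (trunc p d u e)) => // [|j].
    exact: (carry_free_trunc p1 hd u0 hn hkd uk).
  by rewrite lt_trunc.
(* Here the error is minus the sum of the residues over [d], of absolute value at most one by
   [small]. *)
have -> : (\sum_j trunc p d u e j)%:R - k%:R / d%:R * (p ^ e)%:R
    = - ((\sum_j rem p d u e j)%:R / d%:R) :> R.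
  apply: (mulfI dR); rewrite mulrBr -(addrK (\sum_j rem p d u e j)%:R (d%:R * _)) sumE.
  by field.
by rewrite normrN ger0_norm ?divr_ge0 // ler_pdivrMr ?ltr0n // mul1r ler_nat.
Qed.
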